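(* Fix $\alpha_{00}=1$ and $\alpha_{01}=\alpha_{02}=0$, and let $\alpha_{10},\alpha_{30}\in\mathbb{C}$. There exist complex numbers $\alpha_{11},\alpha_{12},\alpha_{20},\alpha_{21},\alpha_{22},\alpha_{31},\alpha_{32}$ such that $$|\alpha_{j0}|^2+|\alpha_{j1}|^2+|\alpha_{j2}|^2=1\quad (j=0,1,2,3),$$ $$\alpha_{00}\overline{\alpha_{20}}=0,$$ $$\alpha_{11}\overline{\alpha_{22}}+\alpha_{12}\overline{\alpha_{21}}=0,$$ $$\alpha_{10}\overline{\alpha_{30}}+\alpha_{11}\overline{\alpha_{31}}+\alpha_{12}\overline{\alpha_{32}}=0,$$ $$\alpha_{21}\overline{\alpha_{32}}+\alpha_{22}\overline{\alpha_{31}}=0$$ if and only if $$|\alpha_{10}|^2+|\alpha_{30}|^2=1.$$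
   Context: All $\alpha_{jk}$ ($j=0,1,2,3$, $k=0,1,2$) are complex numbers and $\overline{z}$ denotes complex conjugation. *)

(* Defs.v *)
From mathcomp Require Export all_boot all_order all_algebra.
From mathcomp Require Export reals.
From mathcomp Require Export complex.

(* The field of complex numbers is [R[i]] with [R : realType].  The modulus
   [`|z|] is itself an element of [R[i]] (the real number sqrt(a^2+b^2), embedded),
   so sums of squared moduli are compared with 1 in [R[i]]. *)

(* Main.v *)
Require Import Defs.
From mathcomp Require Import all_boot all_order all_algebra.
From mathcomp Require Import reals.
From mathcomp Require Import complex.
From mathcomp Require Import ring.
Import Order.TTheory GRing.Theory Num.Theory.
Local Open Scope ring_scope.

(** Since [a00 = 1], the vector [(a20, a21, a22)] is a unit vector [(0, u, v)].
    The two bilinear conditions against it put the pairs [(a11, a12)] and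
    [(a31, a32)] on one complex line, the one spanned by the conjugate of the unit
    vector [(u, - v)] ([collinear_of_cross_orthogonal]). With coordinates [s] and
    [t] on this line, the remaining orthogonality reads [s * t^* = - a10 * a30^*],
    while normalization gives [`|s|^2 = 1 - `|a10|^2] and
    [`|t|^2 = 1 - `|a30|^2]. Taking squared moduli yields
    [(1 - `|a10|^2) * (1 - `|a30|^2) = `|a10|^2 * `|a30|^2], whose quadratic terms
    cancel and leave [`|a10|^2 + `|a30|^2 = 1]. Conversely, on the line with
    [(u, v) = (1, 0)] the choice [s = - a30^*], [t = a10^*] works. *)

(** The coordinate [s = x * u - y * v] is the Hermitian product of [(x, y)] with
    the conjugate of the unit vector [(u, - v)]. *)
Lemma collinear_of_cross_orthogonal (C : numClosedFieldType) (u v x y : C) :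
    `|u| ^+ 2 + `|v| ^+ 2 = 1 -> x * v^* + y * u^* = 0 ->
  exists s : C, x = s * u^* /\ y = - (s * v^*).
Proof.
rewrite !normCK => uv1 xy0; exists (x * u - y * v).
have xv : x * v^* = - (y * u^*) by apply/eqP; rewrite -addr_eq0 xy0.
split.
  have -> : (x * u - y * v) * u^* = x * (u * u^*) - (y * u^*) * v by ring.
  by rewrite -mulNr -xv -mulrA -mulrDr (mulrC v^*) uv1 mulr1.
have -> : - ((x * u - y * v) * v^*) = - (x * v^*) * u + y * (v * v^*) by ring.
by rewrite xv opprK -mulrA -mulrDr (mulrC u^*) uv1 mulr1.
Qed.

Lemma sqr_norm_on_unit_line (C : numClosedFieldType) (u v s : C) :
    `|u| ^+ 2 + `|v| ^+ 2 = 1 ->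
  `|s * u^*| ^+ 2 + `|- (s * v^*)| ^+ 2 = `|s| ^+ 2.
Proof.
by move=> uv1; rewrite normrN !normrM !norm_conjC !exprMn -mulrDr uv1 mulr1.
Qed.

Lemma dot_on_unit_line (C : numClosedFieldType) (u v s t : C) :
    `|u| ^+ 2 + `|v| ^+ 2 = 1 ->
  s * u^* * (t * u^*)^* + - (s * v^*) * (- (t * v^*))^* = s * t^*.
Proof.
rewrite !normCK rmorphN !rmorphM /= !conjCK => uv1.
rewrite -[RHS]mulr1 -uv1; ring.
Qed.

Theorem proposition2 (R : realType) (a00 a01 a02 a10 a30 : R[i])
    (h00 : a00 = 1) (h01 : a01 = 0) (h02 : a02 = 0) :
  (exists a11 a12 a20 a21 a22 a31 a32 : R[i],
      (`|a00| ^+ 2 + `|a01| ^+ 2 + `|a02| ^+ 2 = 1) /\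
      (`|a10| ^+ 2 + `|a11| ^+ 2 + `|a12| ^+ 2 = 1) /\
      (`|a20| ^+ 2 + `|a21| ^+ 2 + `|a22| ^+ 2 = 1) /\
      (`|a30| ^+ 2 + `|a31| ^+ 2 + `|a32| ^+ 2 = 1) /\
      (a00 * a20^* = 0) /\
      (a11 * a22^* + a12 * a21^* = 0) /\
      (a10 * a30^* + a11 * a31^* + a12 * a32^* = 0) /\
      (a21 * a32^* + a22 * a31^* = 0))
  <->
  `|a10| ^+ 2 + `|a30| ^+ 2 = 1.
Proof.
rewrite {a00}h00 {a01}h01 {a02}h02; split; last first.
  move=> n1; exists (- a30^*), 0, 0, 1, 0, a10^*, 0.
  rewrite normrN !norm_conjC !normr0 !normr1 !conjC0 conjCK expr1n expr0n /=.
  by rewrite !(mulr0, mul0r, addr0, add0r) [`|a30| ^+ 2 + _]addrC mulNr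
    (mulrC a10) subrr.
case=> a11 [a12] [a20] [u] [v] [a31] [a32].
case=> _ [n1 [n2 [n3 [o02 [o12 [o13 o23]]]]]].
have a20_0 : a20 = 0 by apply/eqP; rewrite -conjC_eq0 -[_^*]mul1r o02.
rewrite a20_0 normr0 expr0n add0r in n2.
(* Conjugation brings the condition on [(a31, a32)] to the form of that on [(a11, a12)]. *)
have o32 : a31 * v^* + a32 * u^* = 0.
  by rewrite -[RHS]conjC0 -o23 rmorphD !rmorphM /= !conjCK addrC !(mulrC _^*).
have [s [e11 e12]] := collinear_of_cross_orthogonal _ _ _ _ _ n2 o12.
have [t [e31 e32]] := collinear_of_cross_orthogonal _ _ _ _ _ n2 o32.
move: n1 n3 o13; rewrite e11 e12 e31 e32 -!addrA.
rewrite !sqr_norm_on_unit_line // dot_on_unit_line // => n1 n3 o13.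
have st : `|s| ^+ 2 * `|t| ^+ 2 = `|a10| ^+ 2 * `|a30| ^+ 2.
  have /(congr1 (fun z => `|z| ^+ 2)) : s * t^* = - (a10 * a30^*).
    by apply/eqP; rewrite -addr_eq0 addrC o13.
  by rewrite normrN !normrM !norm_conjC !exprMn.
move/(canRL (addKr _)): n1 st => ->; move/(canRL (addKr _)): n3 => -> st.
apply/eqP; rewrite eq_sym -subr_eq0; apply/eqP.
by rewrite -(subrr (`|a10| ^+ 2 * `|a30| ^+ 2)) -{1}st; ring.
Qed.
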